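(* There is a universal constant $c>0$ such that the following holds. Let $n\in\mathbb{N}$ and let $f:\{0,1\}^n\to\{0,1\}$ be a monotone function. Let $t\in\mathbb{N}$ and $q>0$. Let $\mathcal{D}_0,\mathcal{D}_1$ be distributions over $\{0,1\}^n$ such that $\mathcal{D}_1$ is $t$-wise $q$-spread, and let $$\alpha:=\min\Big\{\Pr_{x\sim\mathcal{D}_0}[f(x)=0],\ \Pr_{x\sim\mathcal{D}_1}[f(x)=1]\Big\}.$$ Let $w\in\mathbb{N}$ with $w\leq t/2$, and define $r_w:=\max_{\ell\in[2w]} r(\mathcal{D}_0,\ell,\alpha n^{-3w})$. If $8r_w\leq q\leq r_w n$, then any monotone Boolean circuit computing $f$ has size at least $\left(\frac{c\alpha q}{r_w}\right)^w$.
   Context: For $S\subseteq[n]$, let $\mathbb{1}_S:\{0,1\}^n\to\{0,1\}$ be $\mathbb{1}_S(x)=\bigwedge_{i\in S}x_i$, with $\mathbb{1}_\emptyset\equiv 1$. For a distribution $\mathcal{D}$ on $\{0,1\}^n$ and $\varepsilon>0$, a family $\mathcal{S}\subseteq\mathcal{P}([n])$ is a $(\mathcal{D},\varepsilon)$-sunflower if $|\mathcal{S}|\geq 2$ and $\Pr_{x\sim\mathcal{D}}[\exists S\in\mathcal{S}:\ \mathbb{1}_{S\setminus K}(x)=1]>1-\varepsilon$, where $K:=\bigcap_{S\in\mathcal{S}}S$. A family is $\ell$-uniform if all its sets have size exactly $\ell$. $r(\mathcal{D},\ell,\varepsilon)$ is the minimum integer $r$ such that every $\ell$-uniform family of sets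 of size at least $r^\ell$ contains a $(\mathcal{D},\varepsilon)$-sunflower ($\infty$ if no such $r$ exists). For $t\in\mathbb{N}$ and $q>0$, a distribution $\mathcal{D}$ over $\{0,1\}^n$ is $t$-wise $q$-spread if for every $A\subseteq[n]$ with $|A|\leq t$, $\Pr_{x\sim\mathcal{D}}[\mathbb{1}_A(x)=1]\leq q^{-|A|}$. A monotone Boolean circuit has fan-in two $\wedge,\vee$ gates over input variables; its size is its number of gates. $[k]=\{1,\dots,k\}$.
   Formalization: Circuits are required to have at least one gate, with a gate as output; a bare input variable is not counted as a circuit of size 0, since for f = x_1 the stated positive lower bound would then fail. *)

(* Defs.v *)
From HB Require Import structures.
From mathcomp Require Import all_boot all_order all_algebra.
From mathcomp Require Import boolp reals constructive_ereal.

Set Implicit Arguments.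
Unset Strict Implicit.
Unset Printing Implicit Defensive.

Import Order.TTheory GRing.Theory Num.Theory.
Local Open Scope ring_scope.

Definition cube (n : nat) := {ffun 'I_n -> bool}.

Definition monotone (n : nat) (f : cube n -> bool) : Prop :=
  forall x y : cube n, (forall i, x i -> y i) -> f x -> f y.

Definition ind (n : nat) (S : {set 'I_n}) (x : cube n) : bool :=
  [forall i in S, x i].

Record dist (R : realType) (n : nat) := Dist {
  pmf :> {ffun cube n -> R};
  pmf_ge0 : forall x, 0 <= pmf x;
  pmf_sum1 : \sum_x pmf x = 1 }.

Definition Pr (R : realType) (n : nat) (D : dist R n) (E : pred (cube n)) : R :=
  \sum_(x | E x) D x.

Section Sunflower.
Variables (R : realType) (n : nat) (D : dist R n).

Definition kernel (F : {set {set 'I_n}}) : {set 'I_n} := \bigcap_(S in F) S.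

Definition sunflower (eps : R) (F : {set {set 'I_n}}) : bool :=
  (2 <= #|F|)%N &&
  (1 - eps < Pr D (fun x => [exists S in F, ind (S :\: kernel F) x])).

Definition uniform (l : nat) (F : {set {set 'I_n}}) : bool :=
  [forall S in F, #|S| == l].

Definition sunflower_bound (l : nat) (eps : R) (r : nat) : bool :=
  [forall F : {set {set 'I_n}},
     uniform l F && (r ^ l <= #|F|)%N ==>
     [exists G : {set {set 'I_n}}, (G \subset F) && sunflower eps G]].

Definition sunflower_number (l : nat) (eps : R) : \bar R :=
  match pselect (exists r, sunflower_bound l eps r) with
  | left exr => ((ex_minn exr)%:R)%:E
  | right _ => +oo%E
  end.

(* All sunflower numbers are nonnegative, so starting the maximum at 0 only
   matters over an empty range, i.e. for [w = 0]. *)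
Definition max_sunflower_number (w : nat) (eps : R) : \bar R :=
  \big[maxe/0%E]_(1 <= l < (2 * w).+1) sunflower_number l eps.

Definition spread (t : nat) (q : R) : Prop :=
  forall A : {set 'I_n}, (#|A| <= t)%N -> Pr D (ind A) <= q ^- #|A|.

End Sunflower.

Inductive gate_op := And_gate | Or_gate.

Definition gate_fun (o : gate_op) : bool -> bool -> bool :=
  match o with And_gate => andb | Or_gate => orb end.

(* Circuits over [n] input variables with [s] gates, listed in topological
   order.  Each operand of a gate is an input variable ([inl]) or an earlier
   gate ([inr]), with unbounded fan-out. *)
Inductive circuit (n : nat) : nat -> Type :=
| Empty_circuit : circuit n 0
| Add_gate (s : nat) of
    circuit n s & gate_op & ('I_n + 'I_s)%type & ('I_n + 'I_s)%type :
    circuit n s.+1.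

Definition operand_val (n s : nat) (x : cube n) (v : 'I_s -> bool)
    (a : 'I_n + 'I_s) : bool :=
  match a with inl i => x i | inr g => v g end.

Fixpoint gate_val (n s : nat) (C : circuit n s) (x : cube n) : 'I_s -> bool :=
  match C in circuit _ s return 'I_s -> bool with
  | Empty_circuit => fun _ => false
  | Add_gate s C o a b => fun g =>
      if unlift ord_max g is Some h then gate_val C x h
      else gate_fun o (operand_val x (gate_val C x) a)
                      (operand_val x (gate_val C x) b)
  end.

(* The output is a gate: a bare input variable is not a circuit, so every
   circuit has size at least 1. *)
Definition computes (n s : nat) (C : circuit n s) (out : 'I_s)
    (f : cube n -> bool) : Prop :=
  forall x, gate_val C x out = f x.

(* Main.v *)
(** Razborov's method of approximations.  Every gate is approximated by a family
    of sets of size at most [w], read as the disjunction of the conjunctions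
    [ind S].  The exact combination of two such families has sets of size at
    most [2w]; as long as it has too many sets of some size [l], it contains a
    sunflower, which is replaced by its kernel.  Each replacement shrinks the
    family, so there are few of them, and each errs rarely under [D0].  The sets
    of size above [w] are then dropped, which by spreadness and by their small
    number errs rarely under [D1].  The family obtained at the output either
    contains the empty set, hence accepts everything, or by the same count is
    rarely accepting under [D1]; both force many gates. *)
Require Import Defs.
From mathcomp Require Import all_boot all_order all_algebra.
From mathcomp Require Import boolp reals constructive_ereal.
From mathcomp Require Import zify lra.
Import Order.TTheory GRing.Theory Num.Theory.
Local Open Scope ring_scope.

Set Implicit Arguments.
Unset Strict Implicit.

(** * Elementary probability on the cube *)

Section Probability.
Context {R : realType} {n : nat}.
Variable D : dist R n.
Implicit Types E : pred (cube n).

Lemma Pr_ge0 E : 0 <= Pr D E.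
Proof. by apply: sumr_ge0 => x _; exact: pmf_ge0. Qed.

Lemma Pr_le E E' : (forall x, E x -> E' x) -> Pr D E <= Pr D E'.
Proof.
move=> sEE'; rewrite /Pr [leLHS]big_mkcond [leRHS]big_mkcond /=.
apply: ler_sum => x _; case: ifP => [/sEE' -> //|_].
by case: ifP => // _; exact: pmf_ge0.
Qed.

Lemma PrT E : (forall x, E x) -> Pr D E = 1.
Proof.
by move=> ET; rewrite -(pmf_sum1 D) /Pr; apply: eq_bigl => x; rewrite ET.
Qed.

Lemma Pr_le1 E : Pr D E <= 1.
Proof. by rewrite -(@PrT predT) //; apply: Pr_le. Qed.

Lemma PrC E : Pr D (fun x => ~~ E x) = 1 - Pr D E.
Proof.
by rewrite -(pmf_sum1 D) (bigID E) /= /Pr addrAC subrr add0r.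
Qed.

Lemma PrU E E' : Pr D (fun x => E x || E' x) <= Pr D E + Pr D E'.
Proof.
rewrite /Pr [leLHS]big_mkcond [X in X + _]big_mkcond [X in _ + X]big_mkcond /=.
rewrite -big_split.
apply: ler_sum => x _ /=; have := pmf_ge0 D x.
by case: (E x); case: (E' x) => /=; lra.
Qed.

Lemma Pr_bigcup (I : finType) (P : pred I) (E : I -> pred (cube n)) :
  Pr D (fun x => [exists i, P i && E i x]) <= \sum_(i | P i) Pr D (E i).
Proof.
under eq_bigr do rewrite /Pr big_mkcond /=.
rewrite exchange_big /Pr big_mkcond /=; apply: ler_sum => x _.
have ge0 i : 0 <= if E i x then D x else 0 by case: ifP => // _; exact: pmf_ge0.
case: ifP => [/existsP[i /andP[Pi Ei]]|_]; last exact: sumr_ge0.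
by rewrite (bigD1 i) //= Ei lerDl; apply: sumr_ge0.
Qed.

End Probability.

(** * Families of sets as monotone disjunctive normal forms *)

Definition accepts {n : nat} (F : {set {set 'I_n}}) (x : cube n) : bool :=
  [exists S in F, ind S x].

Definition level {n : nat} (F : {set {set 'I_n}}) (l : nat) : {set {set 'I_n}} :=
  [set S in F | #|S| == l].

Section Families.
Context {n : nat}.
Implicit Types (S T : {set 'I_n}) (F G : {set {set 'I_n}}) (x : cube n).

Lemma accepts_sub F G x : F \subset G -> accepts F x -> accepts G x.
Proof.
move=> /subsetP sFG /existsP[S /andP[SF Sx]].
by apply/existsP; exists S; rewrite sFG.
Qed.

Lemma indU S T x : ind (S :|: T) x = ind S x && ind T x.
Proof.
apply/forall_inP/andP => [h|[/forall_inP hS /forall_inP hT] i].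
  by split; apply/forall_inP => i iS; apply: h; rewrite inE iS ?orbT.
by rewrite inE => /orP[/hS|/hT].
Qed.

Lemma ind0 x : ind set0 x.
Proof. by apply/forall_inP => i; rewrite inE. Qed.

Lemma accepts1 S x : accepts [set S] x = ind S x.
Proof.
apply/existsP/idP => [[T /andP[/set1P -> //]]|Sx].
by exists S; rewrite inE eqxx.
Qed.

Lemma ind1 (i : 'I_n) x : ind [set i] x = x i.
Proof.
by apply/forall_inP/idP => [|xi j /set1P -> //]; apply; rewrite inE.
Qed.

Lemma acceptsU F G x : accepts (F :|: G) x = accepts F x || accepts G x.
Proof.
apply/existsP/orP => [[S /andP[/setUP[SF|SG] Sx]]|].
- by left; apply/existsP; exists S; rewrite SF.
- by right; apply/existsP; exists S; rewrite SG.
- by case=> /existsP[S /andP[SF Sx]]; exists S; rewrite inE SF ?orbT.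
Qed.

Lemma accepts_join F G x :
  accepts [set S :|: T | S in F, T in G] x = accepts F x && accepts G x.
Proof.
apply/existsP/andP => [[U /andP[/imset2P[S T SF TG ->]]]|[]].
  rewrite indU => /andP[Sx Tx]; split; apply/existsP; first by exists S; rewrite SF.
  by exists T; rewrite TG.
move=> /existsP[S /andP[SF Sx]] /existsP[T /andP[TG Tx]].
by exists (S :|: T); rewrite imset2_f // indU Sx.
Qed.

Definition combine (o : gate_op) F G : {set {set 'I_n}} :=
  match o with
  | And_gate => [set S :|: T | S in F, T in G]
  | Or_gate => F :|: G
  end.

Lemma accepts_combine o F G x :
  accepts (combine o F G) x = gate_fun o (accepts F x) (accepts G x).
Proof. by case: o; rewrite ?accepts_join ?acceptsU. Qed.

Lemma card_combine o F G (a b : nat) S :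
  (forall T, T \in F -> (#|T| <= a)%N) -> (forall T, T \in G -> (#|T| <= b)%N) ->
  S \in combine o F G -> (#|S| <= a + b)%N.
Proof.
move=> Fa Gb; case: o => [/imset2P[T U /Fa Ta /Gb Ub ->]|/setUP[/Fa|/Gb] Sab].
- by rewrite (leq_trans (leq_card_setU _ _)) // leq_add.
- by rewrite (leq_trans Sab) ?leq_addr.
- by rewrite (leq_trans Sab) ?leq_addl.
Qed.

(** Such a set is built from [set0] in [m] moves, each inserting one of the [n] points or, through
    [None], doing nothing. *)
Lemma card_small_sets (m : nat) :
  (#|[set S : {set 'I_n} | (#|S| <= m)%N]| <= n.+1 ^ m)%N.
Proof.
elim: m => [|m IHm].
  rewrite expn0 -(cards1 (set0 : {set 'I_n})) subset_leq_card //.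
  by apply/subsetP => S; rewrite !inE leqn0 cards_eq0.
pose extend (p : option 'I_n * {set 'I_n}) :=
  if p.1 is Some i then i |: p.2 else p.2.
have sub : [set S : {set 'I_n} | (#|S| <= m.+1)%N] \subset
    extend @: setX [set: option 'I_n] [set S : {set 'I_n} | (#|S| <= m)%N].
  apply/subsetP => S; rewrite inE => cS; apply/imsetP.
  have [->|[i iS]] := set_0Vmem S.
    by exists (None, set0); rewrite // !inE /= cards0.
  exists (Some i, S :\ i); last by rewrite /extend /= setD1K.
  by rewrite !inE /=; move: cS; rewrite (cardsD1 i) iS.
apply: leq_trans (subset_leq_card sub) _; apply: leq_trans (leq_imset_card _ _) _.
by rewrite cardsX cardsT card_option card_ord expnS leq_mul2l IHm orbT.
Qed.

End Families.

(** * Replacing sunflowers by their kernels *)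

Section Plucking.
Context {R : realType} {n : nat}.
Variables (D : dist R n) (m : nat) (eps rho : R).
Hypothesis eps_ge0 : 0 <= eps.
Hypothesis bound : forall l, (0 < l <= m)%N ->
  exists2 r, sunflower_bound D l eps r & r%:R <= rho.
Implicit Types (S T : {set 'I_n}) (F G : {set {set 'I_n}}).

(** Once the kernel holds at [x], a set of [G] holds exactly when its petal does. An error thus
    means that all petals fail, which the sunflower condition makes rare. *)
Lemma sunflower_error G : sunflower D eps G ->
  Pr D (fun x => ind (kernel G) x && ~~ accepts G x) <= eps.
Proof.
move=> /andP[_ Gsun].
apply: le_trans (_ : Pr D (fun x => ~~ [exists S in G, ind (S :\: kernel G) x]) <= _).
  apply: Pr_le => x /andP[Kx]; apply: contra => /existsP[S /andP[SG Sx]].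
  apply/existsP; exists S; rewrite SG /=.
  have -> : S = kernel G :|: (S :\: kernel G).
    by rewrite setDE setUIr setUCr setIT; apply/esym/setUidPr/bigcap_inf.
  by rewrite indU Kx Sx.
by rewrite PrC; lra.
Qed.

(** Induction on the size of [F]: each replacement costs one [eps] and removes at least one set, so
    [#|F|] copies of [eps] pay for all of them. *)
Lemma pluck F : (forall S, S \in F -> (#|S| <= m)%N) ->
  exists F' : {set {set 'I_n}},
  [/\ forall S, S \in F' -> (#|S| <= m)%N,
      forall l, (0 < l <= m)%N -> #|level F' l|%:R <= rho ^+ l,
      forall x, accepts F x -> accepts F' x
    & Pr D (fun x => accepts F' x && ~~ accepts F x) <= #|F|%:R * eps].
Proof.
have [k] := ubnP #|F|; elim: k F => // k IHk F; rewrite ltnS => leFk Fm.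
have [small|] := pselect (forall l, (0 < l <= m)%N -> #|level F l|%:R <= rho ^+ l).
  exists F; split=> //; rewrite /Pr big_pred0 ?mulr_ge0 // => x.
  by case: accepts.
move=> /existsNP[l] /not_implyP[lm] /negP; rewrite -ltNge => large.
have [r /forallP /(_ (level F l)) /implyP rl rrho] := bound lm.
have unif : uniform l (level F l).
  by apply/forall_inP => S; rewrite inE => /andP[].
(* Since [r <= rho], a level with more than [rho ^+ l] sets has at least [r ^ l] of them. *)
have [|G /andP[GF Gsun]] := existsP (rl _).
  rewrite unif /= -(ler_nat R) natrX; apply: le_trans (ltW large).
  by apply: lerXn2r; rewrite ?nnegrE // (le_trans (ler0n R r) rrho).
have sGF : G \subset F.
  by apply: subset_trans GF _; apply/subsetP => S; rewrite inE => /andP[].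
have card_G : (1 < #|G|)%N by case/andP: Gsun.
pose F1 := kernel G |: (F :\: G).
have F1m S : S \in F1 -> (#|S| <= m)%N.
  case/setU1P => [->|/setDP[/Fm //]].
  have /card_gt0P[T TG] : (0 < #|G|)%N by apply: ltnW.
  apply: leq_trans (Fm T _); last exact: (subsetP sGF).
  by apply/subset_leq_card/bigcap_inf.
(* At least two sets leave and at most one enters. *)
have card_F1 : (#|F1| < #|F|)%N.
  rewrite /F1 cardsU1; have := cardsD F G; rewrite (setIidPr sGF) => ->.
  move: card_G (subset_leq_card sGF); case: (_ \notin _);
    by move: #|G| #|F| => g k'; lia.
have [F' [F'm F'small FF' err]] := IHk F1 (leq_trans card_F1 leFk) F1m.
have FF1 x : accepts F x -> accepts F1 x.
  move=> /existsP[S /andP[SF Sx]]; rewrite /F1 acceptsU accepts1.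
  have [SG|SG] := boolP (S \in G); last first.
    by apply/orP; right; apply/existsP; exists S; rewrite !inE SG SF.
  have : ind (kernel G :|: S) x by rewrite (setUidPr _) // bigcap_inf.
  by rewrite indU => /andP[->].
exists F'; split=> // [x /FF1 /FF' //|].
apply: le_trans (_ : #|F1|%:R * eps + eps <= _); last first.
  by rewrite -{2}[eps]mul1r -mulrDl ler_wpM2r // natr1 ler_nat.
apply: (le_trans _ (lerD err (sunflower_error Gsun))).
apply: (le_trans _ (PrU _ _ _)); apply: Pr_le => x /andP[F'x NFx]; rewrite F'x /=.
(* If [F1] rejects [x], the error is due to later replacements; otherwise [x] was let in by the new
   kernel alone. *)
have [F1x|//] := boolP (accepts F1 x).
rewrite /= (contraNN _ NFx) ?andbT; last exact: accepts_sub.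
move: F1x; rewrite acceptsU accepts1 => /orP[//|F1x].
by case/negP: NFx; apply: accepts_sub F1x; exact: subsetDl.
Qed.

End Plucking.

(** * Approximating gates and circuits *)

Lemma geometric_sum_le (R : realFieldType) (x : R) (a b : nat) :
  0 <= x -> x <= 2^-1 -> \sum_(a <= i < b) x ^+ i <= 2 * x ^+ a.
Proof.
move=> x0 xhalf; have [ba|/ltnW ab] := leqP b a.
  by rewrite big_geq // mulr_ge0 // exprn_ge0.
(* The subtracted term lets the induction close: [2 * x ^+ k.+1 <= x ^+ k] because [x <= 1/2]. *)
suff : \sum_(a <= i < b) x ^+ i <= 2 * x ^+ a - 2 * x ^+ b.
  by have := exprn_ge0 b x0; lra.
rewrite -(subnKC ab); elim: (b - a)%N => [|k IHk].
  by rewrite addn0 big_geq // subrr.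
rewrite addnS big_nat_recr ?leq_addr //= exprS.
have := exprn_ge0 (a + k) x0; nra.
Qed.

(** Monotone gates keep one-sided errors one-sided. *)
Lemma gate_fun_mono (o : gate_op) (u v u' v' : bool) :
  (u -> u') -> (v -> v') -> gate_fun o u v -> gate_fun o u' v'.
Proof.
by case: o => /= hu hv => [/andP[/hu -> /hv ->]|/orP[/hu ->|/hv ->]]; rewrite ?orbT.
Qed.

Section Approximation.
Context {R : realType} {n : nat}.
Variables (D0 D1 : dist R n) (t w : nat) (q eps rho : R).
Hypothesis spreadD1 : spread D1 t q.
Hypothesis w_le_t : (2 * w <= t)%N.
Hypothesis w_gt0 : (0 < w)%N.
Hypothesis rho_ge0 : 0 <= rho.
Hypothesis q_gt0 : 0 < q.
Hypothesis rho_le_q : 2 * rho <= q.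
Hypothesis eps_ge0 : 0 <= eps.
Hypothesis bound : forall l, (0 < l <= 2 * w)%N ->
  exists2 r, sunflower_bound D0 l eps r & r%:R <= rho.
Implicit Types (S T : {set 'I_n}) (F G : {set {set 'I_n}}).

(** Union bound by size: level [l] contributes at most [(rho / q) ^+ l], and the ratio is at most
    1/2, so the sum is at most twice its first term. *)
Lemma Pr_accepts_le (a b : nat) F : (0 < a)%N -> (b <= 2 * w)%N ->
  (forall S, S \in F -> (a <= #|S| <= b)%N) ->
  (forall l, (a <= l <= b)%N -> #|level F l|%:R <= rho ^+ l) ->
  Pr D1 (accepts F) <= 2 * (rho / q) ^+ a.
Proof.
move=> a0 bw Fab Fsmall; apply: le_trans (Pr_bigcup _ _ _) _.
have ratio : 0 <= rho / q <= 2^-1.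
  by rewrite divr_ge0 ?(ltW q_gt0) //= ler_pdivrMr //; move: rho_le_q; lra.
case/andP: ratio => ratio0 ratio1.
apply: (le_trans _ (geometric_sum_le a b.+1 ratio0 ratio1)).
apply: le_trans (_ : \sum_(S in F) q ^- #|S| <= _).
  apply: ler_sum => S SF; apply: spreadD1; apply: leq_trans w_le_t.
  by apply: leq_trans bw; case/andP: (Fab S SF).
(* Each term becomes a one-term sum over the size [l], so that exchanging the sums groups the sets
   by level. *)
under eq_bigr => S SF.
  have <- : \sum_(a <= l < b.+1 | l == #|S|) q ^- l = q ^- #|S|.
    by rewrite big_nat1_eq ltnS Fab.
  over.
rewrite (exchange_big_dep predT) //= [leLHS]big_nat [leRHS]big_nat.
apply: ler_sum => l; rewrite ltnS => /Fsmall small.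
rewrite sumr_const expr_div_n -[leLHS]mulr_natl ler_pM2r ?invr_gt0 ?exprn_gt0 //.
apply: le_trans small; rewrite ler_nat subset_leq_card //.
by apply/subsetP => S; rewrite !inE eq_sym.
Qed.

(** Plucking only enlarges the accepted set and trimming only shrinks it. Hence false acceptances
    come from plucking alone, and false rejections from the trimmed sets, whose sizes start at
    [w.+1]. *)
Lemma approximate_gate F :
  (forall S, S \in F -> (#|S| <= 2 * w)%N) ->
  exists F' : {set {set 'I_n}},
  [/\ forall S, S \in F' -> (#|S| <= w)%N,
      forall l, (0 < l <= w)%N -> #|level F' l|%:R <= rho ^+ l,
      Pr D0 (fun x => accepts F' x && ~~ accepts F x) <= n.+1%:R ^+ (2 * w) * eps
    & Pr D1 (fun x => accepts F x && ~~ accepts F' x) <= 2 * (rho / q) ^+ w.+1].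
Proof.
move=> Fw; have [G [Gw Gsmall FG err]] := pluck eps_ge0 bound Fw.
have w2 : (w <= 2 * w)%N by rewrite leq_pmull.
pose G' := [set S in G | (#|S| <= w)%N].
have sG'G : G' \subset G by apply/subsetP => S; rewrite inE => /andP[].
exists G'; split.
- by move=> S; rewrite inE => /andP[].
- move=> l /andP[l0 lw]; apply: le_trans (Gsmall l _); last first.
    by rewrite l0 (leq_trans lw).
  rewrite ler_nat subset_leq_card //; apply/subsetP => S.
  by rewrite !inE => /andP[/andP[-> _] ->].
- apply: le_trans (_ : #|F|%:R * eps <= _).
    apply: le_trans err; apply: Pr_le => x /andP[G'x ->].
    by rewrite (accepts_sub sG'G).
  rewrite ler_wpM2r // -natrX ler_nat; apply: leq_trans (card_small_sets _).
  by apply/subset_leq_card/subsetP => S /Fw; rewrite inE.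
pose H := [set S in G | (w < #|S|)%N].
have Hw S : S \in H -> (w < #|S| <= 2 * w)%N.
  by rewrite inE => /andP[/Gw SG ->].
apply: le_trans (_ : Pr D1 (accepts H) <= _).
  apply: Pr_le => x /andP[/FG /existsP[S /andP[SG Sx]] NG'x].
  apply/existsP; exists S; rewrite Sx inE SG ltnNge /= andbT.
  by apply: contra NG'x => Sw; apply/existsP; exists S; rewrite inE SG Sw.
apply: Pr_accepts_le Hw _ => // l /andP[wl l2w].
apply: le_trans (Gsmall l _); last by rewrite l2w (leq_trans _ wl).
rewrite ler_nat subset_leq_card //; apply/subsetP => S.
by rewrite !inE => /andP[/andP[-> _] ->].
Qed.

Definition operand_approx (s : nat) (A : 'I_s -> {set {set 'I_n}})
    (a : 'I_n + 'I_s) : {set {set 'I_n}} :=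
  match a with inl i => [set [set i]] | inr g => A g end.

(** [E0] and [E1] collect the errors of all gates, one summand per gate. Input operands are
    represented exactly and add none. *)
Lemma approximate_circuit (s : nat) (C : circuit n s) :
  exists (A : 'I_s -> {set {set 'I_n}}) (E0 E1 : pred (cube n)),
  [/\ forall g S, S \in A g -> (#|S| <= w)%N,
      forall g l, (0 < l <= w)%N -> #|level (A g) l|%:R <= rho ^+ l,
      forall x g, ~~ E0 x -> accepts (A g) x -> gate_val C x g,
      forall x g, ~~ E1 x -> gate_val C x g -> accepts (A g) x
    & Pr D0 E0 <= s%:R * (n.+1%:R ^+ (2 * w) * eps) /\
      Pr D1 E1 <= s%:R * (2 * (rho / q) ^+ w.+1)].
Proof.
elim: C => [|{}s C [A [E0 [E1 [Aw Asmall A0 A1 [e0 e1]]]]] o a b].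
  exists (fun=> set0), pred0, pred0; split=> [[]|[]|x []|x []|] //.
  by rewrite /Pr !big_pred0 // !mul0r.
have opw c S : S \in operand_approx A c -> (#|S| <= w)%N.
  by case: c => [i /set1P ->|g /Aw //]; rewrite cards1.
pose B := operand_approx A a; pose B' := operand_approx A b.
pose F := combine o B B'.
have FE x : accepts F x = gate_fun o (accepts B x) (accepts B' x).
  exact: accepts_combine.
have Fw S : S \in F -> (#|S| <= 2 * w)%N.
  by rewrite mul2n -addnn; apply: card_combine => T; apply: opw.
have op0 x c : ~~ E0 x -> accepts (operand_approx A c) x ->
    operand_val x (gate_val C x) c.
  by case: c => [i|g] Ex /=; [rewrite accepts1 ind1|apply: A0].
have op1 x c : ~~ E1 x -> operand_val x (gate_val C x) c ->
    accepts (operand_approx A c) x.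
  by case: c => [i|g] Ex /=; [rewrite accepts1 ind1|apply: A1].
have [F' [F'w F'small err0 err1]] := approximate_gate Fw.
exists (fun g => if unlift ord_max g is Some h then A h else F').
exists (fun x => E0 x || accepts F' x && ~~ accepts F x).
exists (fun x => E1 x || accepts F x && ~~ accepts F' x).
split.
- by move=> g S; case: unliftP => [h _ /Aw|_ /F'w].
- by move=> g l lw; case: unliftP => [h _|_]; [apply: Asmall|apply: F'small].
- move=> x g; rewrite negb_or => /andP[Ex NF] /=.
  case: unliftP => [h _|_ F'x]; first exact: A0.
  move: NF; rewrite F'x /= negbK FE; apply: gate_fun_mono; exact: op0.
- move=> x g; rewrite negb_or => /andP[Ex NF] /=.
  case: unliftP => [h _|_ Cx]; first exact: A1.
  have Fx : accepts F x by rewrite FE; apply: gate_fun_mono Cx; exact: op1.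
  by move: NF; rewrite Fx /= negbK.
- rewrite -natr1; split; rewrite mulrDl mul1r;
    by apply: le_trans (PrU _ _ _) (lerD _ _).
Qed.

(** The two alternatives are the error forced under [D0] by an approximator that
    accepts everything and under [D1] by one that rarely accepts. *)
Lemma error_dichotomy (f : cube n -> bool) (s : nat) (C : circuit n s)
    (out : 'I_s) : computes C out f ->
  Pr D0 (fun x => f x == false) <= s%:R * (n.+1%:R ^+ (2 * w) * eps) \/
  Pr D1 (fun x => f x == true) <=
    2 * (rho / q) + s%:R * (2 * (rho / q) ^+ w.+1).
Proof.
move=> Cf.
have [A [E0 [E1 [Aw Asmall A0 A1 [e0 e1]]]]] := approximate_circuit C.
have [out0|out0] := boolP (set0 \in A out).
  left; apply: le_trans e0; apply: Pr_le => x /eqP fx.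
  apply/negPn/negP => Ex.
  have /(A0 _ _ Ex) : accepts (A out) x.
    by apply/existsP; exists set0; rewrite out0 ind0.
  by rewrite Cf fx.
right; apply: le_trans (_ : Pr D1 (fun x => accepts (A out) x || E1 x) <= _).
  apply: Pr_le => x /eqP fx; have [//|Ex] := boolP (E1 x); first by rewrite orbT.
  by rewrite (A1 x out Ex) // Cf fx.
apply: le_trans (PrU _ _ _) _; apply: lerD e1; rewrite -[rho / q]expr1.
apply: (@Pr_accepts_le 1 w) => // [|S SA|]; first by rewrite leq_pmull.
  by rewrite (Aw _ _ SA) card_gt0 andbT; apply: contraNneq out0 => <-.
exact: Asmall.
Qed.

End Approximation.

(** * Finite sunflower numbers and the final estimate *)

Lemma max_sunflower_number_fin (R : realType) (n : nat) (D : dist R n) (w : nat)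
    (eps : R) : (max_sunflower_number D w eps < +oo)%E ->
  exists rho : R,
  [/\ max_sunflower_number D w eps = rho%:E, 0 <= rho
    & forall l, (0 < l <= 2 * w)%N ->
      exists2 r, sunflower_bound D l eps r & r%:R <= rho].
Proof.
have max_ge0 : (0%E <= max_sunflower_number D w eps)%E by exact: bigmax_ge_id.
have max_ge l : (0 < l <= 2 * w)%N ->
    (sunflower_number D l eps <= max_sunflower_number D w eps)%E.
  move=> lw; rewrite /max_sunflower_number.
  apply: (@le_bigmax_seq _ _ _ _ _ l xpredT (fun k => sunflower_number D k eps)) => //.
  by rewrite mem_index_iota ltnS.
case: (max_sunflower_number D w eps) max_ge0 max_ge => [rho||] //.
rewrite lee_fin => rho0 max_ge _; exists rho; split=> // l /max_ge.
(* A finite maximum rules out the infinite branch; in the other, the minimum is itself a valid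
   [r]. *)
rewrite /sunflower_number; case: pselect => [exr|_]; last by rewrite leye_eq.
by case: ex_minnP => r rl _; rewrite lee_fin; exists r.
Qed.

Theorem theorem3p3 (R : realType) :
  exists c : R, 0 < c /\
  forall (n : nat) (f : cube n -> bool), monotone f ->
  forall (t : nat) (q : R), 0 < q ->
  forall D0 D1 : dist R n, spread D1 t q ->
  let alpha := Num.min (Pr D0 (fun x => f x == false))
                       (Pr D1 (fun x => f x == true)) in
  forall w : nat, w%:R <= t%:R / 2 :> R ->
  let r_w := max_sunflower_number D0 w (alpha * n%:R ^- (3 * w)) in
  (8%:E * r_w <= q%:E)%E ->
  (q%:E <= r_w * n%:R%:E)%E ->
  forall (s : nat) (C : circuit n s) (out : 'I_s), computes C out f ->
  (c * alpha * q / fine r_w) ^+ w <= s%:R.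
Proof.
(* The value 1/4 serves both cases: [n / 4 * (2 * n) ^+ 2] is exactly [n ^+ 3] under [D0], and
   [4 * y < alpha] is what [D1] requires. *)
exists 4^-1; split; first by rewrite invr_gt0.
move=> n f _ t q q0 D0 D1 spreadD1 alpha w wt r_w rq qr s C out Cf.
have s1 : 1 <= s%:R :> R by rewrite ler1n (leq_ltn_trans _ (ltn_ord out)).
have [->|w0] := posnP w; first by rewrite expr0.
have w2t : (2 * w <= t)%N.
  by rewrite -(ler_nat R) natrM; move: wt; lra.
have alpha0 : 0 <= alpha by rewrite le_min !Pr_ge0.
have alpha1 : alpha <= 1 by rewrite ge_min !Pr_le1.
have eps0 : 0 <= alpha * n%:R ^- (3 * w).
  by rewrite mulr_ge0 // invr_ge0 exprn_ge0.
(* An infinite [r_w] would contradict [8 * r_w <= q] with [q] real. *)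
have r_w_fin : (r_w < +oo)%E.
  rewrite ltey; apply: contraTneq rq => ->.
  by rewrite gt0_muley ?lte_fin // leye_eq.
have [rho [r_wE rho0 bound]] := max_sunflower_number_fin r_w_fin.
rewrite /r_w r_wE in rq qr *; rewrite /= in rq qr *.
rewrite -!EFinM !lee_fin in rq qr.
have rho_gt0 : 0 < rho.
  rewrite lt_neqAle rho0 andbT; apply: contraTneq qr => <-.
  by rewrite mul0r -ltNge.
have n0 : 0 < n%:R :> R.
  rewrite lt_neqAle ler0n andbT; apply: contraTneq qr => <-.
  by rewrite mulr0 -ltNge.
pose y := rho / q.
have y0 : 0 < y by rewrite divr_gt0.
have ny1 : 1 <= n%:R * y.
  by rewrite /y mulrA ler_pdivlMr // mul1r mulrC.
have -> : 4^-1 * alpha * q / rho = 4^-1 * alpha / y.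
  by rewrite /y invf_div mulrA.
set X := _ / y; have X0 : 0 <= X by rewrite divr_ge0 ?mulr_ge0 ?invr_ge0 // ltW.
have XE : X * y = 4^-1 * alpha by rewrite /X divfK // gt_eqF.
rewrite leNgt; apply/negP => small.
(* Otherwise the claimed bound is at most 1, and the output gate already gives [1 <= s]. *)
have X1 : 1 < X.
  rewrite ltNge; apply/negP => X1.
  by have := le_lt_trans s1 small; rewrite ltNge exprn_ile1.
have alpha_gt0 : 0 < alpha by have := mulr_gt0 (lt_trans ltr01 X1) y0; lra.
have y_lt : y < 4^-1 * alpha by rewrite -XE ltr_pMl.
(* Because [X * y = alpha / 4 <= 1 / 4 <= n * y / 4]. *)
have Xn : X <= n%:R / 4.
  rewrite -(ler_pM2r y0) XE; nra.
have rho_le_q : 2 * rho <= q by lra.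
have [err|err] := error_dichotomy spreadD1 w2t w0 rho0 q0 rho_le_q eps0 bound Cf.
  have : alpha <= s%:R * (n.+1%:R ^+ (2 * w) * (alpha * n%:R ^- (3 * w))).
    by apply: le_trans err; rewrite ge_min lexx.
  apply/negP; rewrite -ltNge.
  have K0 : 0 < n.+1%:R ^+ (2 * w) * (alpha * n%:R ^- (3 * w)).
    by rewrite !mulr_gt0 ?invr_gt0 ?exprn_gt0.
  (* With [alpha] factored out, what remains is the [w]-th power of [X * n.+1 ^+ 2 / n ^+ 3], which
     is at most 1. *)
  apply: (@lt_le_trans _ _ (X ^+ w * (n.+1%:R ^+ (2 * w) * (alpha * n%:R ^- (3 * w))))).
    by rewrite ltr_pM2r.
  rewrite !exprM -exprVn [_ * (alpha * _)]mulrCA [X in X <= _]mulrCA -!exprMn.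
  rewrite -[leRHS]mulr1 ler_wpM2l // exprn_ile1 //.
    by rewrite mulr_ge0 // divr_ge0 // exprn_ge0.
  have n1 : n.+1%:R <= 2 * n%:R :> R.
    by rewrite -natrM ler_nat mul2n -addnn -add1n leq_add2r -(ltr0n R).
  rewrite mulrA ler_pdivrMr ?exprn_gt0 // mul1r.
  apply: (@le_trans _ _ (n%:R / 4 * (2 * n%:R) ^+ 2)).
    by rewrite ler_pM ?exprn_ge0 // lerXn2r // nnegrE ?mulr_ge0.
  lra.
have : alpha <= 2 * y + s%:R * (2 * y ^+ w.+1).
  by apply: le_trans err; rewrite ge_min lexx orbT.
apply/negP; rewrite -ltNge.
(* Here [s * y ^+ w] is at most [(X * y) ^+ w = (alpha / 4) ^+ w <= 1]; the total error is then at
   most [4 * y < alpha]. *)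
have : s%:R * (2 * y ^+ w.+1) <= 2 * y.
  rewrite exprSr [2 * _]mulrCA [leLHS]mulrA ler_piMl //; first by have := y0; lra.
  apply: (@le_trans _ _ (X ^+ w * y ^+ w)).
    by rewrite ler_wpM2r ?exprn_ge0 // ltW.
  by rewrite -exprMn XE exprn_ile1 //; lra.
lra.
Qed.
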